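(* Let $(S,\mathcal F,\mathcal L)$ be a $p$-local finite group at an odd prime $p$. Then $(S,\mathcal F,\mathcal L)$ is nilpotent if and only if every elementary abelian normal subgroup $V\trianglelefteq S$ is $\mathcal F$-weakly closed and $\mathrm{Aut}_{\mathcal F}(V)$ is a $p$-group.
   Context: A subgroup of $S$ is $\mathcal F$-weakly closed if no other subgroup of $S$ is $\mathcal F$-conjugate to it. Let $S$ be a finite $p$-group. For $P,Q\le S$, $\mathrm{Hom}_S(P,Q)$ is the set of maps $c_g\colon x\mapsto gxg^{-1}$ with $g\in S$, $gPg^{-1}\le Q$, and $\mathrm{Aut}_S(P)=\mathrm{Hom}_S(P,P)$. A fusion system $\mathcal F$ over $S$ is a category whose objects are the subgroups of $S$, with $\mathrm{Hom}_S(P,Q)\subseteq\mathrm{Hom}_{\mathcal F}(P,Q)\subseteq \mathrm{Inj}(P,Q)$, such that every morphism factors as an $\mathcal F$-isomorphism followed by an inclusion. Subgroups are $\mathcal F$-conjugate if they are isomorphic in $\mathcal F$. $P$ is fully centralized (resp. fully normalized) if $|C_S(P)|\ge |C_S(P')|$ (resp. $|N_S(P)|\ge|N_S(P')|$) for all $P'$ $\mathcal F$-conjugate to $P$. $\mathcal F$ is saturated if (I) every fully normalized $P$ is fully centralized and $\mathrm{Aut}_S(P)$ is a Sylow $p$-subgroup of $\mathrm{Aut}_{\mathcal F}(P)$, and (II) whenever $\phi\in\mathrm{Hom}_{\mathcal F}(P,S)$ with $\phi(P)$ fully centralized, $\phi$ extends to a morphism in $\mathcal F$ defined on $N_\phi=\{g\in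 N_S(P):\phi c_g\phi^{-1}\in \mathrm{Aut}_S(\phi(P))\}$. $P$ is $\mathcal F$-centric if $C_S(P')\le P'$ for all $P'$ $\mathcal F$-conjugate to $P$; $\mathcal F^c$ is the full subcategory on these. A centric linking system associated to $\mathcal F$ is a category $\mathcal L$ with objects the $\mathcal F$-centric subgroups, a functor $\pi\colon\mathcal L\to\mathcal F^c$ which is the identity on objects, and monomorphisms $\delta_P\colon P\to\mathrm{Aut}_{\mathcal L}(P)$, such that (A) $Z(P)$ (via $\delta_P$) acts freely on $\mathrm{Mor}_{\mathcal L}(P,Q)$ by composition and $\pi$ induces a bijection $\mathrm{Mor}_{\mathcal L}(P,Q)/Z(P)\to\mathrm{Hom}_{\mathcal F}(P,Q)$; (B) $\pi(\delta_P(g))=c_g$ for $g\in P$; (C) $f\circ\delta_P(g)=\delta_Q(\pi(f)(g))\circ f$ for $f\in\mathrm{Mor}_{\mathcal L}(P,Q)$, $g\in P$. A $p$-local finite group is a triple $(S,\mathcal F,\mathcal L)$ with $\mathcal F$ a saturated fusion system over $S$ and $\mathcal L$ an associated centric linking system. $(S,\mathcal F,\mathcal L)$ is called nilpotent if $\mathcal F=\mathcal F_S(S)$, the fusion system with $\mathrm{Hom}_{\mathcal F_S(S)}(P,Q)=\mathrm{Hom}_S(P,Q)$. *)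

(* Defs.v *)
From HB Require Import structures.
From mathcomp Require Import all_boot all_fingroup all_solvable.
Set Implicit Arguments. Unset Strict Implicit. Unset Printing Implicit Defensive.
Local Open Scope group_scope.

(* Conventions.
   A morphism P -> Q of a fusion system is represented as a finite function
   f : {ffun gT -> gT} which is an injective homomorphism on P with image in
   Q, and which is normalized by f x = 1 for x outside P (so that a morphism
   is determined by its restriction to P).  A fusion system over S is a map
   F : {set gT} -> {set gT} -> {set {ffun gT -> gT}} giving Hom_F(P,Q); only
   its values on subgroups P, Q of S matter. *)

Section Fusion.
Variable gT : finGroupType.
Notation fmap := {ffun gT -> gT}.
Notation fsys := ({set gT} -> {set gT} -> {set fmap}).

Definition restr (P : {set gT}) (f : gT -> gT) : fmap :=
  [ffun x => if x \in P then f x else 1].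

Definition fcomp (g f : fmap) : fmap := [ffun x => g (f x)].

Definition injhom (P Q : {set gT}) (f : fmap) : Prop :=
  [/\ {in P &, {morph f : x y / x * y}}, {in P &, injective f},
      f @: P \subset Q & forall x, x \notin P -> f x = 1].

(* c_g : x |-> g x g^-1 ; in MathComp x ^ y = y^-1 x y *)
Definition cmap (g : gT) : gT -> gT := fun x => x ^ g^-1.

Definition HomS (S P Q : {set gT}) : {set fmap} :=
  [set restr P (cmap g) | g in S & P :^ g^-1 \subset Q].

Definition is_fusion_system (S : {set gT}) (F : fsys) : Prop :=
  forall P Q R : {group gT}, P \subset S -> Q \subset S -> R \subset S ->
  [/\ HomS S P Q \subset F P Q,
      (forall f, f \in F P Q -> injhom P Q f),
      (forall f g, f \in F P Q -> g \in F Q R -> fcomp g f \in F P R) &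
      (forall f, f \in F P Q ->
         f \in F P (f @: P) /\
         exists2 h, h \in F (f @: P) P &
           fcomp h f = restr P id /\ fcomp f h = restr (f @: P) id)].

Definition Fconj (F : fsys) (P P' : {set gT}) : Prop :=
  exists2 f, f \in F P P' & f @: P = P'.

Definition weakly_closed (S : {set gT}) (F : fsys) (V : {set gT}) : Prop :=
  forall V' : {group gT}, V' \subset S -> Fconj F V V' -> V' :=: V.

Definition fully_centralized (S : {set gT}) (F : fsys) (P : {set gT}) : Prop :=
  forall P' : {group gT}, P' \subset S -> Fconj F P P' ->
    #|'C_S(P')| <= #|'C_S(P)|.

Definition fully_normalized (S : {set gT}) (F : fsys) (P : {set gT}) : Prop :=
  forall P' : {group gT}, P' \subset S -> Fconj F P P' ->
    #|'N_S(P')| <= #|'N_S(P)|.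

Definition Nphi (S P : {set gT}) (f : fmap) : {set gT} :=
  [set g in 'N_S(P) |
     [exists h in S, [forall x in P, f (x ^ g^-1) == f x ^ h^-1]]].

(* Aut_S(P) is a Sylow p-subgroup of Aut_F(P) = F P P
   (written out: p-subgroup of p'-index) *)
Definition AutS_Sylow (p : nat) (S : {set gT}) (F : fsys) (P : {set gT}) :=
  [/\ HomS S P P \subset F P P, p.-nat #|HomS S P P|
    & p^'.-nat (#|F P P| %/ #|HomS S P P|)].

Definition saturated (p : nat) (S : {set gT}) (F : fsys) : Prop :=
  [/\ is_fusion_system S F,
      (forall P : {group gT}, P \subset S -> fully_normalized S F P ->
         fully_centralized S F P /\ AutS_Sylow p S F P) &
      (forall (P : {group gT}) (f : fmap), P \subset S -> f \in F P S ->
         fully_centralized S F (f @: P) ->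
         exists2 g, g \in F (Nphi S P f) S & {in P, forall x, g x = f x})].

Definition Fcentric (S : {set gT}) (F : fsys) (P : {set gT}) : Prop :=
  forall P' : {group gT}, P' \subset S -> Fconj F P P' -> 'C_S(P') \subset P'.

Definition cobj (S : {set gT}) (F : fsys) (P : {group gT}) : Prop :=
  P \subset S /\ Fcentric S F P.

Record linking_system (S : {set gT}) (F : fsys) := LinkingSystem {
  Lmor : {group gT} -> {group gT} -> Type;
  Lid : forall P : {group gT}, Lmor P P;
  Lcomp : forall P Q R : {group gT}, Lmor Q R -> Lmor P Q -> Lmor P R;
  Lpi : forall P Q : {group gT}, Lmor P Q -> fmap;
  Ldelta : forall P : {group gT}, gT -> Lmor P P;
  L_assoc : forall (P Q R T : {group gT}) (f : Lmor P Q) (g : Lmor Q R)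
      (h : Lmor R T), cobj S F P -> cobj S F Q -> cobj S F R -> cobj S F T ->
      @Lcomp _ _ _ h (@Lcomp _ _ _ g f) = @Lcomp _ _ _ (@Lcomp _ _ _ h g) f;
  L_idl : forall (P Q : {group gT}) (f : Lmor P Q), cobj S F P -> cobj S F Q ->
      @Lcomp _ _ _ (Lid Q) f = f;
  L_idr : forall (P Q : {group gT}) (f : Lmor P Q), cobj S F P -> cobj S F Q ->
      @Lcomp _ _ _ f (Lid P) = f;
  L_pi_in : forall (P Q : {group gT}) (f : Lmor P Q), cobj S F P -> cobj S F Q ->
      @Lpi _ _ f \in F P Q;
  L_pi_id : forall P : {group gT}, cobj S F P -> @Lpi _ _ (Lid P) = restr P id;
  L_pi_comp : forall (P Q R : {group gT}) (f : Lmor P Q) (g : Lmor Q R),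
      cobj S F P -> cobj S F Q -> cobj S F R ->
      @Lpi _ _ (@Lcomp _ _ _ g f) = fcomp (@Lpi _ _ g) (@Lpi _ _ f);
  L_delta1 : forall P : {group gT}, cobj S F P -> Ldelta P 1 = Lid P;
  L_deltaM : forall P : {group gT}, cobj S F P ->
      {in P &, forall g h, Ldelta P (g * h) = @Lcomp _ _ _ (Ldelta P g) (Ldelta P h)};
  L_deltaI : forall P : {group gT}, cobj S F P -> {in P &, injective (Ldelta P)};
  L_A_free : forall (P Q : {group gT}) (f : Lmor P Q) (z : gT),
      cobj S F P -> cobj S F Q -> z \in 'Z(P) ->
      @Lcomp _ _ _ f (Ldelta P z) = f -> z = 1;
  L_A_surj : forall (P Q : {group gT}) (phi : fmap), cobj S F P -> cobj S F Q ->
      phi \in F P Q -> exists f : Lmor P Q, @Lpi _ _ f = phi;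
  L_A_fibre : forall (P Q : {group gT}) (f f' : Lmor P Q),
      cobj S F P -> cobj S F Q -> @Lpi _ _ f = @Lpi _ _ f' ->
      exists2 z, z \in 'Z(P) & f' = @Lcomp _ _ _ f (Ldelta P z);
  L_B : forall P : {group gT}, cobj S F P ->
      {in P, forall g, @Lpi _ _ (Ldelta P g) = restr P (cmap g)};
  L_C : forall (P Q : {group gT}) (f : Lmor P Q), cobj S F P -> cobj S F Q ->
      {in P, forall g, @Lcomp _ _ _ f (Ldelta P g) =
                      @Lcomp _ _ _ (Ldelta Q (@Lpi _ _ f g)) f}
}.

Definition nilpotent_fs (S : {set gT}) (F : fsys) : Prop :=
  forall P Q : {group gT}, P \subset S -> Q \subset S -> F P Q = HomS S P Q.

End Fusion.

(* Main.v *)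
Require Import Defs.
From HB Require Import structures.
From mathcomp Require Import all_boot all_fingroup all_solvable.
Set Implicit Arguments. Unset Strict Implicit. Unset Printing Implicit Defensive.
Local Open Scope group_scope.

(* Let W be elementary abelian and normal in S.  By induction along
   1 < ... < [W, S] < W, every F-morphism defined on P extends to P W: once
   [W, S] <= P, conjugation by an element of W acts on a fully normalized
   conjugate R of P as an automorphism that is trivial on [W, S] and on
   R / [W, S]; such automorphisms form a normal p-subgroup of Aut_F(R), hence
   lie in Aut_S(R), and the extension axiom applies.  Weak closure ensures that
   the extension maps W to itself.
   Now let V be maximal among these W, so that V contains all elements of order
   p of C_S(V) (p is odd).  For P >= V, a p'-element of Aut_F(P) acts trivially
   on V because Aut_F(V) is a p-group, and a p'-automorphism of P that is
   trivial on V is trivial.  So Aut_F(P) is a p-group for all P >= V, and a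
   downward induction on |P|, as in Frobenius' criterion, shows that every
   morphism defined on P is conjugation by an element of S. *)

(** * Coprime automorphisms of a p-group *)

Lemma autX_fixed_mul (gT : finGroupType) (P : {group gT}) (a : {perm gT})
    (x c : gT) n :
  a \in Aut P -> x \in P -> c \in P -> a x = x * c -> a c = c ->
  (a ^+ n) x = x * c ^+ n.
Proof.
move=> Aa Px Pc ax ac; elim: n => [|n IHn]; first by rewrite expg0 perm1 mulg1.
rewrite expgSr permM IHn -[a _]/(autm Aa _) morphM ?groupX //= morphX //=.
by rewrite !autmE ax ac -mulgA -expgS.
Qed.

(** [a ^+ q] sends [x] to [x * c ^+ q], so [c ^+ q = 1]; since [c] has p-power order, [c = 1]. *)
Lemma coprime_aut_fixed (gT : finGroupType) (p q : nat) (P : {group gT})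
    (a : {perm gT}) (x c : gT) :
  p.-group P -> coprime p q -> a \in Aut P -> a ^+ q = 1 ->
  x \in P -> c \in P -> a x = x * c -> a c = c -> a x = x.
Proof.
move=> pP copq Aa aq Px Pc ax ac.
have cq : c ^+ q = 1.
  by apply: (mulgI x); rewrite -(autX_fixed_mul q Aa) // aq perm1 mulg1.
suff c1 : c = 1 by rewrite ax c1 mulg1.
apply/eqP; rewrite -order_eq1 -dvdn1.
have /p_natP[n oc] : p.-nat #[c] by exact: mem_p_elt pP Pc.
have /eqP <- : coprime (p ^ n) q by rewrite coprimeXl.
by rewrite dvdn_gcd -oc dvdnn order_dvdn cq eqxx.
Qed.

(** * Automorphisms of P that are trivial on V, for odd p *)

Section OddAutomorphism.
Variables (gT : finGroupType) (p : nat) (P V : {group gT}).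
Hypotheses (pr_p : prime p) (p_odd : odd p) (pP : p.-group P).
Hypotheses (sVP : V \subset P) (nVP : P \subset 'N(V)).
Hypothesis max_V : {in 'C_P(V), forall x, x ^+ p = 1 -> x \in V}.

(* On a critical subgroup H the p-th power map is a homomorphism, since H has
   class 2, p is odd and 'Phi(H) is central; so for x in 'C_H(V) with x ^+ p
   fixed by a, the element x^-1 * a x has p-th power 1, hence lies in V. *)
Lemma odd_stab_Aut_pgroup : p.-group 'C(V | [Aut P]).
Proof.
have [H critH] := Thompson_critical pP.
have [chH sPhiZ sRZ _] := critH; have sHP := char_sub chH.
have pCH := critical_p_stab_Aut critH pP.
apply/pgroupP=> q pr_q /Cauchy[] // a cVa oa.
have Aa : a \in Aut P by apply: (subsetP _ _ cVa); rewrite subsetIl.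
have aV : {in V, forall v, a v = v}.
  by move: cVa; rewrite /= astab_ract => /setIP[_ /astabP]; apply.
have aq : a ^+ q = 1 by rewrite -oa expg_order.
have aM : {in P &, {morph a : x y / x * y}}.
  by move=> x y Px Py; rewrite -!(autmE Aa) morphM.
have aJ : {in P &, {morph a : x y / x ^ y}}.
  by move=> x y Px Py; rewrite -!(autmE Aa) morphJ.
have aX n : {in P, {morph a : x / x ^+ n}}.
  by move=> x Px; rewrite -!(autmE Aa) morphX.
have aP x : x \in P -> a x \in P by move=> Px; rewrite Aut_closed.
have aH x : x \in H -> a x \in H.
  move=> Hx; have /andP[_ /forall_inP/(_ a Aa)/subsetP] := chH.
  by apply; rewrite imset_f.
case: (eqVneq q p) => [->|neq_qp]; first by rewrite inE.
have copq : coprime p q by rewrite prime_coprime // dvdn_prime2 // eq_sym.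
have fixa := coprime_aut_fixed pP copq Aa aq.
have aC x : x \in 'C_P(V) -> a x \in 'C_P(V).
  case/setIP=> Px /centP cVx; rewrite inE aP //=; apply/centP=> v Vv.
  have Pv := subsetP sVP _ Vv.
  by rewrite /commute -[v in LHS]aV // -aM // cVx // aM // aV.
(* Induction on the order of [x]: the hypothesis applied to [x ^+ p] gives [axp]. *)
have fix_CHV n x : #[x] <= n -> x \in H -> x \in 'C(V) -> a x = x.
  elim: n x => [|n IHn] x; first by rewrite leqNgt order_gt0.
  move=> ox Hx cVx; have Px := subsetP sHP _ Hx.
  have CPx : x \in 'C_P(V) by rewrite inE Px.
  have [->|nt_x] := eqVneq x 1; first by rewrite aV.
  have axp : a x ^+ p = x ^+ p.
    rewrite -aX //; apply: IHn; rewrite ?groupX // -ltnS (leq_trans _ ox) //.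
    have p_x : p %| #[x].
      have p_x : p.-group <[x]> by apply: mem_p_elt pP Px.
      by have [] := pgroup_pdiv p_x; rewrite ?cycle_eq1.
    by rewrite orderXdiv // ltn_Pdiv ?prime_gt1.
  set c := x^-1 * a x.
  have HcC : c \in 'C_P(V) by rewrite groupM ?groupV ?aC.
  have Zxp y : y \in H -> y ^+ p \in 'Z(H).
    move=> Hy; apply: (subsetP sPhiZ); rewrite (Phi_joing (pgroupS sHP pP)).
    have p_y : p.-elt y by apply: mem_p_elt pP (subsetP sHP _ Hy).
    by apply: (subsetP (joing_subr _ _)); apply: (Mho_p_elt 1 Hy p_y).
  have cR y z t : y \in H -> z \in H -> t \in H -> commute t [~ y, z].
    move=> Hy Hz Ht; have : [~ y, z] \in 'Z(H).
      by apply: (subsetP sRZ); rewrite mem_commg // (subsetP sHP).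
    by case/centerP=> _ cZ; apply/commute_sym/cZ.
  have Hax := aH _ Hx; have Hx' : x^-1 \in H by rewrite groupV.
  have cp : c ^+ p = 1.
    rewrite /c expMg_Rmul; [|exact: cR|exact: cR].
    rewrite axp expgVn mulVg mul1g.
    (* Since p is odd, the exponent of the commutator [[~ a x, x^-1]] is a multiple of p, and its
       p-th power is the commutator of [a x] with the central element [x^-1 ^+ p]. *)
    have /dvdnP[k ->] : p %| 'C(p, 2).
      rewrite prime_dvd_bin //= ltn_neqAle prime_gt1 // andbT eq_sym.
      by case: (p) p_odd => [|[|[]]].
    rewrite mulnC expgM -commgX; last exact: cR.
    have /centerP[_ cZ] := Zxp _ Hx'.
    have /commgP/eqP -> : commute (a x) (x^-1 ^+ p) by apply/commute_sym/cZ.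
    by rewrite expg1n.
  have Vc := max_V HcC cp.
  by apply: (fixa x c); [| exact: (subsetP sVP) | rewrite mulKVg | exact: aV].
(* Automorphisms trivial on the critical subgroup [H] form a p-group, so it remains to see that [a]
   fixes [H] pointwise. *)
suff cHa : a \in 'C(H | [Aut P]) by have := mem_p_elt pCH cHa; rewrite /p_elt oa pnatE.
rewrite /= astab_ract inE Aa; apply/astabP=> x Hx /=.
have Px := subsetP sHP _ Hx.
(* [a] fixes [v ^ x^-1], an element of V; conjugating it by [a x] therefore gives [a v = v]. *)
have CVc : x^-1 * a x \in 'C(V).
  apply/centP=> v Vv; apply/commute_sym/commgP/conjg_fixP.
  have Vvx : v ^ x^-1 \in V by rewrite memJ_norm // groupV (subsetP nVP).
  by rewrite conjgM -(aV _ Vvx) -aJ ?(subsetP sVP _ Vvx) // conjgKV aV.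
have Hc : x^-1 * a x \in H by rewrite groupM ?groupV ?aH.
apply: (fixa x (x^-1 * a x)); rewrite ?mulKVg ?(subsetP sHP _ Hc) //.
exact: fix_CHV (leqnn _) Hc CVc.
Qed.
End OddAutomorphism.

(** * Elementary properties of fusion systems *)

Section FusionSystem.
Variables (gT : finGroupType) (S : {group gT}).
Variable F : {set gT} -> {set gT} -> {set {ffun gT -> gT}}.
Hypothesis fusF : is_fusion_system S F.
Implicit Types (P Q R : {group gT}) (f g h : {ffun gT -> gT}).

Lemma restrE (P : {set gT}) (f : gT -> gT) : {in P, restr P f =1 f}.
Proof. by move=> x Px; rewrite ffunE Px. Qed.

Lemma fusion_injhom P Q f :
  P \subset S -> Q \subset S -> f \in F P Q -> injhom P Q f.
Proof. by move=> sPS sQS; have [_ homF _ _] := fusF sPS sQS sQS; apply: homF. Qed.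

Lemma fusionM P Q f : P \subset S -> Q \subset S -> f \in F P Q ->
  {in P &, {morph f : x y / x * y}}.
Proof. by move=> sPS sQS /(fusion_injhom sPS sQS)[]. Qed.

Lemma fusion_inj P Q f : P \subset S -> Q \subset S -> f \in F P Q ->
  {in P &, injective f}.
Proof. by move=> sPS sQS /(fusion_injhom sPS sQS)[]. Qed.

Lemma fusion_im P Q f : P \subset S -> Q \subset S -> f \in F P Q ->
  f @: P \subset Q.
Proof. by move=> sPS sQS /(fusion_injhom sPS sQS)[]. Qed.

Lemma fusion_mem P Q f x : P \subset S -> Q \subset S -> f \in F P Q ->
  x \in P -> f x \in Q.
Proof.
by move=> sPS sQS /(fusion_im sPS sQS)/subsetP sfPQ Px; rewrite sfPQ ?imset_f.
Qed.

Lemma fusion_out P Q f x : P \subset S -> Q \subset S -> f \in F P Q ->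
  x \notin P -> f x = 1.
Proof. by move=> sPS sQS /(fusion_injhom sPS sQS)[_ _ _]; apply. Qed.

Lemma fusion1 P Q f : P \subset S -> Q \subset S -> f \in F P Q -> f 1 = 1.
Proof.
move=> sPS sQS /(fusionM sPS sQS) fM.
by apply: (mulgI (f 1)); rewrite -fM // !mulg1.
Qed.

Lemma fusion_comp P Q R f g :
  P \subset S -> Q \subset S -> R \subset S ->
  f \in F P Q -> g \in F Q R -> fcomp g f \in F P R.
Proof. by move=> sPS sQS sRS; have [_ _ + _] := fusF sPS sQS sRS; apply. Qed.

Lemma fusion_conj P Q x : P \subset S -> Q \subset S -> x \in S ->
  P :^ x^-1 \subset Q -> restr P (cmap x) \in F P Q.
Proof.
move=> sPS sQS Sx sPxQ; have [/subsetP homS _ _ _] := fusF sPS sQS sQS.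
by apply/homS/imsetP; exists x; rewrite ?inE ?Sx.
Qed.

Lemma fusion_incl P Q : P \subset Q -> Q \subset S -> restr P id \in F P Q.
Proof.
move=> sPQ sQS; have sPS := subset_trans sPQ sQS.
have ->: restr P id = restr P (cmap 1).
  by apply/ffunP=> x; rewrite !ffunE /cmap invg1 conjg1.
by rewrite fusion_conj // invg1 conjsg1.
Qed.

Lemma fusion_restr P0 P Q f : P0 \subset P -> P \subset S -> Q \subset S ->
  f \in F P Q -> restr P0 f \in F P0 Q.
Proof.
move=> sP0P sPS sQS Ff; have sP0S := subset_trans sP0P sPS.
have -> : restr P0 f = fcomp f (restr P0 id).
  by apply/ffunP=> x; rewrite !ffunE; case: ifP => // _; rewrite (fusion1 sPS sQS Ff).
exact: fusion_comp (fusion_incl sP0P sPS) Ff.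
Qed.

Lemma fusion_widen P Q R f : P \subset S -> Q \subset R -> R \subset S ->
  f \in F P Q -> f \in F P R.
Proof.
move=> sPS sQR sRS Ff; have sQS := subset_trans sQR sRS.
have -> : f = fcomp (restr Q id) f.
  apply/ffunP=> x; rewrite !ffunE.
  have [Px|/(fusion_out sPS sQS Ff)->] := boolP (x \in P); last by rewrite if_same.
  by rewrite (fusion_mem sPS sQS Ff Px).
exact: fusion_comp Ff (fusion_incl sQR sRS).
Qed.

Lemma fusion_img P Q f : P \subset S -> Q \subset S -> f \in F P Q ->
  exists R, [/\ f @: P = R, R \subset Q & #|R| = #|P|].
Proof.
move=> sPS sQS Ff; have fM := fusionM sPS sQS Ff.
have gfP : group_set (f @: P).
  apply/group_setP; split=> [|_ _ /imsetP[x Px ->] /imsetP[y Py ->]].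
    by rewrite -(fusion1 sPS sQS Ff) imset_f.
  by rewrite -fM // imset_f ?groupM.
exists (Group gfP); split=> //=; first exact: fusion_im Ff.
by rewrite card_in_imset //; apply: fusion_inj Ff.
Qed.

Lemma fusion_onto P Q R f : P \subset S -> Q \subset S ->
  f \in F P Q -> f @: P = R -> f \in F P R.
Proof.
by move=> sPS sQS Ff <-; have [_ _ _ /(_ _ Ff)[]] := fusF sPS sQS sQS.
Qed.

Lemma fusion_inv P Q f : P \subset S -> Q \subset S ->
  f \in F P Q -> f @: P = Q ->
  exists h, [/\ h \in F Q P, h @: Q = P, {in P, cancel f h} & {in Q, cancel h f}].
Proof.
move=> sPS sQS Ff fPQ; have [_ _ _ /(_ _ Ff)[_]] := fusF sPS sQS sQS.
rewrite fPQ => -[h Fh [hf fh]].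
have hK : {in P, cancel f h}.
  by move=> x Px; have /ffunP/(_ x) := hf; rewrite !ffunE Px.
have fK : {in Q, cancel h f}.
  by move=> x Qx; have /ffunP/(_ x) := fh; rewrite !ffunE Qx.
exists h; split=> //; apply/eqP; rewrite eqEsubset (fusion_im sQS sPS Fh) /=.
apply/subsetP=> x Px; rewrite -(hK x Px) imset_f //.
exact: fusion_mem Ff Px.
Qed.

Lemma fusion_eq P Q f g : P \subset S -> Q \subset S ->
  f \in F P Q -> g \in F P Q -> {in P, f =1 g} -> f = g.
Proof.
move=> sPS sQS Ff Fg eq_fg; apply/ffunP=> x.
have [/eq_fg //|nPx] := boolP (x \in P).
by rewrite (fusion_out sPS sQS Ff) // (fusion_out sPS sQS Fg).
Qed.

Lemma fusionV P Q f x : P \subset S -> Q \subset S -> f \in F P Q ->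
  x \in P -> f x^-1 = (f x)^-1.
Proof.
move=> sPS sQS Ff Px; apply: (mulgI (f x)).
by rewrite -(fusionM sPS sQS Ff) ?groupV // !mulgV (fusion1 sPS sQS Ff).
Qed.

Lemma fusionJ P Q f x y : P \subset S -> Q \subset S -> f \in F P Q ->
  x \in P -> y \in P -> f (x ^ y) = f x ^ f y.
Proof.
move=> sPS sQS Ff Px Py; rewrite !conjgE !(fusionM sPS sQS Ff) ?groupM ?groupV //.
by rewrite (fusionV sPS sQS Ff).
Qed.

Lemma Fconj_trans P Q R : P \subset S -> Q \subset S -> R \subset S ->
  Fconj F P Q -> Fconj F Q R -> Fconj F P R.
Proof.
move=> sPS sQS sRS [f Ff fPQ] [g Fg gQR]; exists (fcomp g f).
  exact: fusion_comp Ff Fg.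
rewrite -gQR -fPQ -imset_comp; apply: eq_imset => x.
by rewrite !ffunE.
Qed.

(** Take a conjugate of [P] whose normalizer in S is largest; its own conjugates are conjugates of
    [P]. *)
Lemma fully_normalized_conj P : P \subset S ->
  exists R, [/\ R \subset S, fully_normalized S F R & Fconj F P R].
Proof.
move=> sPS; pose cnj (R : {group gT}) :=
  (R \subset S) && [exists f in F P R, f @: P == R].
have cnjP R : reflect (R \subset S /\ Fconj F P R) (cnj R).
  apply: (iffP andP) => -[sRS].
    by case/exists_inP=> f Ff /eqP fPR; split=> //; exists f.
  by case=> f Ff fPR; split=> //; apply/exists_inP; exists f; last apply/eqP.
have cnjPP : cnj P.
  apply/cnjP; split=> //; exists (restr P id); first exact: fusion_incl.
  by rewrite (eq_in_imset (restrE (P := P) id)) imset_id.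
have [R /cnjP[sRS PR] maxR] :=
  @arg_maxnP _ P cnj (fun R : {group gT} => #|'N_S(R)|) cnjPP.
exists R; split=> // R' sR'S RR'; apply: maxR; apply/cnjP; split=> //.
exact: Fconj_trans PR RR'.
Qed.

(** * Aut_F(P) and Aut_S(P) as groups of permutations *)

(* Elements of AutF P are the identity outside P, those of F P P are 1 there. *)
Definition AutF (P : {set gT}) : {set {perm gT}} :=
  [set a in Aut P | restr P a \in F P P].

Lemma AutFP P (a : {perm gT}) : P \subset S ->
  reflect (a \in Aut P /\ exists2 f, f \in F P P & {in P, a =1 f}) (a \in AutF P).
Proof.
move=> sPS; apply: (iffP setIdP) => -[Aa].
  by move=> Fa; split=> //; exists (restr P a) => // x Px; rewrite restrE.
case=> f Ff af; split=> //; suff -> : restr P a = f by [].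
apply/ffunP=> x; rewrite ffunE; case: ifPn => [/af //|nPx].
by rewrite (fusion_out sPS sPS Ff).
Qed.

Lemma AutF_of P f : P \subset S -> f \in F P P ->
  exists2 a, a \in AutF P & {in P, a =1 f}.
Proof.
move=> sPS Ff; have fM := fusionM sPS sPS Ff.
pose a := perm_in (fusion_inj sPS sPS Ff) (fusion_im sPS sPS Ff).
have af : {in P, a =1 f} by apply: perm_inE.
exists a => //; apply/AutFP => //; split; last by exists f.
rewrite inE perm_in_on /=; apply/morphicP=> x y Px Py.
by rewrite !af ?groupM // fM.
Qed.

Lemma AutF_group_set P : P \subset S -> group_set (AutF P).
Proof.
move=> sPS; apply/group_setP; split.
  apply/AutFP => //; split; first exact: group1.
  exists (restr P id); first exact: fusion_incl.
  by move=> x Px; rewrite perm1 restrE.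
move=> a b /AutFP[] // Aa [f Ff af] /AutFP[] // Ab [g Fg bg].
apply/AutFP => //; split; first exact: groupM.
exists (fcomp g f); first exact: fusion_comp Ff Fg.
by move=> x Px; rewrite permM !ffunE -bg ?af // (fusion_mem sPS sPS Ff).
Qed.

Lemma card_AutF P : P \subset S -> #|AutF P| = #|F P P|.
Proof.
move=> sPS; have <- : (fun a : {perm gT} => restr P a) @: AutF P = F P P.
  apply/setP=> f; apply/imsetP/idP => [[a /setIdP[_ Fa] -> //]|Ff].
  have [a AFa af] := AutF_of sPS Ff; exists a => //.
  have [_ Fa] := setIdP AFa; apply: fusion_eq Ff Fa _ => // x Px.
  by rewrite restrE // af.
rewrite card_in_imset // => a b /setIdP[Aa _] /setIdP[Ab _] eq_ab.
apply: (eq_Aut Aa Ab) => x Px.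
by have /ffunP/(_ x) := eq_ab; rewrite !restrE.
Qed.

(** [conj_aut] acts by [y ^ x], which is [cmap x^-1]; hence the inverses in comparisons with
    [HomS]. *)
Definition AutS (P : {group gT}) := conj_aut P @* 'N_S(P).

Lemma AutSP P (a : {perm gT}) :
  reflect (a \in Aut P /\ exists2 x, x \in 'N_S(P) & {in P, forall y, a y = y ^ x})
    (a \in AutS P).
Proof.
rewrite /AutS; apply: (iffP morphimP) => [[x nPx Nx ->]|[Aa [x Nx ax]]].
  split; last by exists x => // y Py; rewrite norm_conj_autE.
  by apply: (subsetP (Aut_conj_aut P 'N_S(P))); apply: mem_morphim.
have nPx : x \in 'N(P) by case/setIP: Nx.
exists x => //; apply: (eq_Aut Aa).
  by apply: (subsetP (Aut_conj_aut P 'N_S(P))); apply: mem_morphim.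
by move=> y Py; rewrite ax // norm_conj_autE.
Qed.

Lemma AutS_sub P : P \subset S -> AutS P \subset AutF P.
Proof.
move=> sPS; apply/subsetP=> a /AutSP[Aa [x /setIP[Sx nPx] ax]].
apply/AutFP => //; split=> //; exists (restr P (cmap x^-1)).
  by rewrite fusion_conj ?groupV // invgK (normP nPx).
by move=> y Py; rewrite restrE // /cmap invgK ax.
Qed.

Lemma card_AutS P : P \subset S -> #|AutS P| = #|HomS S P P|.
Proof.
move=> sPS; have <- : (fun a : {perm gT} => restr P a) @: AutS P = HomS S P P.
  apply/setP=> f; apply/imsetP/imsetP => [[a /AutSP[_ [x /setIP[Sx nPx] ax]] ->]|].
    exists x^-1; first by rewrite inE groupV Sx invgK (normP nPx) /=.
    by apply/ffunP=> y; rewrite !ffunE /cmap invgK; case: ifP => // /ax.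
  case=> x; rewrite inE => /andP[Sx nPx] ->; exists (conj_aut P x^-1).
    by apply: mem_morphim; rewrite ?inE ?groupV ?Sx //.
  apply/ffunP=> y; rewrite !ffunE /cmap; case: ifP => // Py.
  by rewrite norm_conj_autE // inE.
apply/esym/card_in_imset => a b /AutSP[Aa _] /AutSP[Ab _] eq_ab.
apply: (eq_Aut Aa Ab) => x Px.
by have /ffunP/(_ x) := eq_ab; rewrite !restrE.
Qed.

(** * Sylow and extension properties of a saturated system *)

Variable p : nat.
Hypotheses (pr_p : prime p) (pS : p.-group S) (satF : saturated p S F).

Lemma AutS_Sylow R (sRS : R \subset S) : fully_normalized S F R ->
  p.-Sylow(Group (AutF_group_set sRS)) (AutS R).
Proof.
move=> fnR; have [_ /(_ R sRS fnR)[_ [_ pA p'iA]] _] := satF.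
rewrite /pHall -divgS /= AutS_sub //.
by rewrite pgroupE card_AutF // card_AutS // pA.
Qed.

(** [b] is the automorphism f c_v f^-1 that occurs in the definition of N_f. *)
Lemma iso_conj_AutF P R f v : P \subset S -> R \subset S ->
  f \in F P R -> f @: P = R -> v \in 'N_S(P) ->
  exists2 b, b \in AutF R & {in P, forall x, b (f x) = f (x ^ v^-1)}.
Proof.
move=> sPS sRS Ff fPR /setIP[Sv nPv].
have [h [Fh hRP hK fK]] := fusion_inv sPS sRS Ff fPR.
have Fc : restr P (cmap v) \in F P P.
  by rewrite fusion_conj // (normP _) // groupV.
have Fhc := fusion_comp sRS sPS sPS Fh Fc.
have [b Ab bE] := AutF_of sRS (fusion_comp sRS sPS sRS Fhc Ff).
exists b => // x Px; rewrite bE ?(fusion_mem sPS sRS Ff) //.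
by rewrite !ffunE hK // Px.
Qed.

Lemma Nphi_group_set P R f : P \subset S -> R \subset S -> f \in F P R ->
  group_set (Nphi S P f).
Proof.
move=> sPS sRS Ff; apply/group_setP; split.
  rewrite inE group1; apply/exists_inP; exists 1 => //.
  by apply/forall_inP=> x Px; rewrite invg1 !conjg1.
move=> u v /setIdP[Nu /exists_inP[y Sy /forall_inP uy]].
case/setIdP=> Nv /exists_inP[z Sz /forall_inP vz].
rewrite inE groupM //; apply/exists_inP; exists (y * z); first exact: groupM.
apply/forall_inP=> x Px; rewrite !invMg !conjgM.
have Pxv : x ^ v^-1 \in P.
  by rewrite memJ_norm // groupV; case/setIP: Nv.
by rewrite (eqP (uy _ Pxv)) (eqP (vz _ Px)).
Qed.

(** The hypothesis on [U] says that f c_v f^-1 lies in Aut_S(R) for [v] in [U], so [P <*> U] lies in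
    N_f. As [R] is fully centralized, axiom (II) extends [f] to N_f, and the extension is
    restricted. *)
Lemma fully_normalized_extend P R (U : {set gT}) f :
  P \subset S -> R \subset S -> fully_normalized S F R ->
  f \in F P R -> f @: P = R -> U \subset 'N_S(P) ->
  (forall v (b : {perm gT}), v \in U -> b \in AutF R ->
     {in P, forall x, b (f x) = f (x ^ v^-1)} -> b \in AutS R) ->
  exists2 g, g \in F (P <*> U) S & {in P, g =1 f}.
Proof.
move=> sPS sRS fnR Ff fPR sUN AutU; have [_ satI satII] := satF.
have FfS := fusion_widen sPS sRS (subxx S) Ff.
have [|g Fg gf] := satII P f sPS FfS.
  by rewrite fPR; have [] := satI R sRS fnR.
pose N := Group (Nphi_group_set sPS sRS Ff).
have sNS : N \subset S.
  by apply/subsetP=> v /setIdP[/setIP[]].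
have sPUN : P <*> U \subset N.
  rewrite join_subG; apply/andP; split; apply/subsetP=> v Uv.
    have Sv := subsetP sPS _ Uv; rewrite inE in_setI Sv (subsetP (normG P)) //.
    (* For [v] in [P], f c_v f^-1 is conjugation by [f v]. *)
    apply/exists_inP; exists (f v).
      by rewrite (subsetP sRS) // (fusion_mem sPS sRS Ff).
    apply/forall_inP=> x Px.
    by rewrite (fusionJ sPS sRS Ff) ?groupV // (fusionV sPS sRS Ff).
  have Nv := subsetP sUN _ Uv.
  have [b Ab bE] := iso_conj_AutF sPS sRS Ff fPR Nv.
  have /AutSP[_ [y /setIP[Sy _] by_]] := AutU v b Uv Ab bE.
  rewrite inE Nv; apply/exists_inP; exists y^-1; first by rewrite groupV.
  by apply/forall_inP=> x Px; rewrite invgK -bE // by_ ?(fusion_mem sPS sRS Ff).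
exists (restr (P <*> U) g); first exact: (@fusion_restr (P <*> U) N S).
by move=> x Px; rewrite restrE ?gf // mem_gen // inE Px.
Qed.

(** * Extending morphisms over normal elementary abelian subgroups *)

Section NormalAbelem.
Variable W : {group gT}.
Hypotheses (nsWS : W <| S) (abelW : p.-abelem W) (wcW : weakly_closed S F W).

Let sWS : W \subset S. Proof. exact: normal_sub. Qed.

Lemma weakly_closed_im P f : P \subset S -> W \subset P -> f \in F P S ->
  f @: W = W.
Proof.
move=> sPS sWP Ff; have FW := fusion_restr sWP sPS (subxx S) Ff.
have [Q [fWQ sQS _]] := fusion_img sWS (subxx S) FW.
have <- : restr W f @: W = f @: W by apply/eq_in_imset/restrE.
rewrite fWQ; apply: wcW => //; exists (restr W f) => //.
exact: fusion_onto FW fWQ.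
Qed.

Lemma AutF_weakly_closed R a x : R \subset S -> W \subset R ->
  a \in AutF R -> x \in W -> a x \in W.
Proof.
move=> sRS sWR /AutFP[] // _ [f Ff af] Wx.
rewrite af ?(subsetP sWR) //.
have <- := weakly_closed_im sRS sWR (fusion_widen sRS sRS (subxx S) Ff).
exact: imset_f.
Qed.

(* The automorphisms that are trivial on W and on R / W form a normal
   p-subgroup of AutF R, so they lie in every Sylow p-subgroup. *)
Lemma stab_series_AutS R a : R \subset S -> fully_normalized S F R ->
  W \subset R -> a \in AutF R -> {in W, forall x, a x = x} ->
  {in R, forall x, x^-1 * a x \in W} -> a \in AutS R.
Proof.
move=> sRS fnR sWR Aa aW aR.
pose A := Group (AutF_group_set sRS).
pose K := [set a in A | [forall x in W, a x == x]
                        && [forall x in R, x^-1 * a x \in W]].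
have KP b : reflect [/\ b \in A, {in W, forall x, b x = x}
                      & {in R, forall x, x^-1 * b x \in W}] (b \in K).
  apply: (iffP setIdP) => [[Ab /andP[/forall_inP bW /forall_inP bR]] | [Ab bW bR]].
    by split=> // x Wx; apply/eqP/bW.
  split=> //; apply/andP.
  by split; apply/forall_inP=> x Wx; [apply/eqP/bW | apply: bR].
have AutA b : b \in A -> b \in Aut R by case/setIdP.
have AR b x : b \in A -> x \in R -> b x \in R.
  by move/AutA=> Ab Rx; rewrite Aut_closed.
have AM b : b \in A -> {in R &, {morph b : x y / x * y}}.
  by move=> /AutA Ab x y Rx Ry; rewrite -!(autmE Ab) morphM.
have AW b x : b \in A -> x \in W -> b x \in W by apply: AutF_weakly_closed.
have gK : group_set K.
  apply/group_setP; split.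
    by apply/KP; split=> // [x _|x _]; rewrite perm1 ?mulVg.
  move=> b c /KP[Ab bW bR] /KP[Ac cW cR]; apply/KP; split; first exact: groupM.
    by move=> x Wx; rewrite permM bW ?cW.
  move=> x Rx; rewrite permM.
  have -> : x^-1 * c (b x) = x^-1 * b x * ((b x)^-1 * c (b x)).
    by rewrite -mulgA mulKVg.
  by rewrite groupM ?bR ?cR ?AR.
(* [b] fixes [c = x^-1 * b x], an element of W, so [b ^+ p] sends [x] to [x * c ^+ p = x]. *)
have pK : p.-group (Group gK).
  apply/pgroupP=> q pr_q /Cauchy[] // b /KP[Ab bW bR] ob.
  suff /eqP bp : b ^+ p = 1.
    by rewrite -order_dvdn ob dvdn_prime2 // in bp.
  apply: (eq_Aut (A := R)); rewrite ?groupX ?group1 ?AutA // => x Rx.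
  rewrite (autX_fixed_mul (P := R) (c := x^-1 * b x)) ?AutA ?mulKVg //.
  - have [_ _ expW] := and3P abelW.
    by rewrite (exponentP expW) ?bR // mulg1 perm1.
  - by rewrite (subsetP sWR) ?bR.
  - by rewrite bW ?bR.
have nKA : Group gK <| A.
  apply/andP; split; first by apply/subsetP=> b /KP[].
  apply/subsetP=> b Ab; rewrite inE; apply/subsetP=> _ /imsetP[c /KP[Ac cW cR] ->].
  have Ab' : b^-1 \in A by rewrite groupV.
  apply/KP; split=> [|x Wx|x Rx]; first exact: groupJ.
    by rewrite conjgE !permM cW ?AW // permKV.
  (* With [x = b y], the quotient becomes [b (y^-1 * c y)], which is in W because [b] preserves
     W. *)
  rewrite conjgE !permM; set y := b^-1 x.
  have Ry : y \in R by rewrite AR.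
  have -> : c y = y * (y^-1 * c y) by rewrite mulKVg.
  rewrite AM ?(subsetP sWR _ (cR _ Ry)) // {1}/y permKV mulKg.
  by rewrite AW ?cR.
apply: (subsetP (pcore_sub_Hall (AutS_Sylow sRS fnR))).
by apply: (subsetP (pcore_max pK nKA)); apply/KP.
Qed.

End NormalAbelem.

Hypothesis wcF : forall V : {group gT}, V <| S -> p.-abelem V -> weakly_closed S F V.

(** For [v] in [V], f c_v f^-1 is trivial on [W] since [V] is abelian, and on R / W since [P, V] is
    in [W] and [f] preserves [W]. So it lies in Aut_S(R) and [f] extends; by weak closure the
    extension maps [V] onto [V]. *)
Lemma fully_normalized_extend_abelem (W V : {group gT}) P R f :
  W <| S -> V <| S -> p.-abelem V -> W \subset V -> [~: V, S] \subset W ->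
  W \subset P -> P \subset S -> R \subset S -> fully_normalized S F R ->
  f \in F P R -> f @: P = R ->
  exists g, [/\ g \in F (P <*> V) (R <*> V), g @: (P <*> V) = R <*> V
              & {in P, g =1 f}].
Proof.
move=> nsWS nsVS abelV sWV sVSW sWP sPS sRS fnR Ff fPR.
have abelW := abelemS sWV abelV; have wcW := wcF nsWS abelW.
have [sWS sVS] := (normal_sub nsWS, normal_sub nsVS).
have FfS := fusion_widen sPS sRS (subxx S) Ff.
have fWW := weakly_closed_im nsWS wcW sPS sWP FfS.
have fW x : x \in W -> f x \in W by move=> Wx; rewrite -fWW imset_f.
have sWR : W \subset R by rewrite -fWW -fPR imsetS.
have nPV : V \subset 'N(P).
  rewrite -commg_subl commGC; apply: subset_trans sWP; apply: subset_trans sVSW.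
  exact: commgS.
have [||g Fg gf] := fully_normalized_extend sPS sRS fnR Ff fPR (U := V).
- by rewrite subsetI sVS.
- move=> v b Vv Ab bE; apply: (stab_series_AutS nsWS abelW wcW) => //.
    move=> w; rewrite -{1}fWW => /imsetP[x Wx ->].
    rewrite bE ?(subsetP sWP) // conjgE invgK.
    have /centsP cVV : V \subset 'C(V) by case/and3P: abelV.
    by rewrite mulgA (cVV v Vv x) ?(subsetP sWV) // mulgK.
  move=> y; rewrite -fPR => /imsetP[x Px ->]; rewrite bE //.
  have Pxv : x ^ v^-1 \in P by rewrite memJ_norm ?groupV // (subsetP nPV).
  rewrite -(fusionV sPS sRS Ff) // -(fusionM sPS sRS Ff) ?groupV //.
  apply/fW/(subsetP sVSW); rewrite -/(commg x v^-1) commGC.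
  by rewrite mem_commg ?groupV // (subsetP sPS).
have sPVS : P <*> V \subset S by rewrite join_subG sPS.
have sRVS : R <*> V \subset S by rewrite join_subG sRS.
have gM := fusionM sPVS (subxx S) Fg.
have gVV : g @: V = V.
  exact: (weakly_closed_im nsVS (wcF nsVS abelV) sPVS (joing_subr P V) Fg).
have gPV : g @: (P <*> V) = R <*> V.
  have nVS := normal_norm nsVS.
  have [/subsetP Jl /subsetP Jr] := (joing_subl P V, joing_subr P V).
  rewrite !norm_joinEl ?(subset_trans _ nVS) //.
  apply/setP=> z; apply/imsetP/imset2P => [[_ /imset2P[x v Px Vv ->] ->]|].
    exists (f x) (g v); first exact: fusion_mem Ff Px.
      by rewrite -gVV imset_f.
    by rewrite gM ?(gf x) //; [apply: Jl | apply: Jr].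
  case=> y w; rewrite -fPR -{1}gVV => /imsetP[x Px ->] /imsetP[v Vv ->] ->.
  exists (x * v); first exact: mem_mulg.
  by rewrite gM ?(gf x) //; [apply: Jl | apply: Jr].
exists g; split=> //; exact: (fusion_onto (Q := S)).
Qed.

(* W is reached from [~: W, S], which is proper in W as S is nilpotent. *)
Lemma fusion_extend_abelem (W : {group gT}) P f : W <| S -> p.-abelem W ->
  P \subset S -> f \in F P S -> exists2 g, g \in F (P <*> W) S & {in P, g =1 f}.
Proof.
have [n] := ubnP #|W|; elim: n W P f => // n IHn W P f ltWn nsWS abelW sPS Ff.
have [W1|ntW] := eqVneq (W :> {set gT}) 1.
  by exists f; rewrite // W1 joingG1.
pose W0 := [~: W, S]%G; have sWS := normal_sub nsWS.
have prW0 : W0 \proper W.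
  apply: nil_comm_properl (pgroup_nil pS) sWS ntW _.
  by rewrite subsetI subxx normal_norm.
have sW0W := proper_sub prW0.
have nsW0S : W0 <| S by rewrite /normal (subset_trans sW0W) // commg_normr.
have [|g Fg gf] := IHn W0 P f _ nsW0S (abelemS sW0W abelW) sPS Ff.
  by apply: leq_trans (proper_card prW0) _; rewrite -ltnS.
have wcW0 := wcF nsW0S (abelemS sW0W abelW).
set P1 := (P <*> W0)%G in Fg; have sP1S : P1 \subset S.
  by rewrite join_subG sPS normal_sub.
have sW0P1 : W0 \subset P1 by apply: joing_subr.
have defP1W : P1 <*> W = P <*> W by rewrite -joingA (joing_idPr _).
have [Q [gP1Q sQS _]] := fusion_img sP1S (subxx S) Fg.
have FgQ := fusion_onto sP1S (subxx S) Fg gP1Q.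
have [h [Fh hQP1 hK gK]] := fusion_inv sP1S sQS FgQ gP1Q.
have sW0Q : W0 \subset Q.
  by rewrite -(weakly_closed_im nsW0S wcW0 sP1S sW0P1 Fg) -gP1Q imsetS.
(* [Q] need not be fully normalized, so [g] is factored as [k] followed by the inverse of
   [fcomp k h]. Both [k] and [fcomp k h] end in [R] and extend to isomorphisms [k1], [l1] onto
   [R <*> W]. *)
have [R [sRS fnR [k Fk kP1R]]] := fully_normalized_conj sP1S.
have Fkh := fusion_comp sQS sP1S sRS Fh Fk.
have khQR : fcomp k h @: Q = R.
  rewrite -kP1R -hQP1 -imset_comp; apply: eq_imset => x.
  by rewrite ffunE.
have ext := fully_normalized_extend_abelem nsW0S nsWS abelW sW0W (subxx _).
have [k1 [Fk1 k1E k1k]] := ext _ _ _ sW0P1 sP1S sRS fnR Fk kP1R.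
have [l1 [Fl1 l1E l1l]] := ext _ _ _ sW0Q sQS sRS fnR Fkh khQR.
have sJS (T : {group gT}) : T \subset S -> T <*> W \subset S.
  by move=> sTS; rewrite join_subG sTS.
have [m [Fm _ l1K mK]] := fusion_inv (sJS _ sQS) (sJS _ sRS) Fl1 l1E.
(* [m] inverts [l1], so the composite agrees with [g] on [P1], hence with [f] on [P]. *)
rewrite -defP1W; exists (fcomp m k1).
  apply: (fusion_widen (sJS _ sP1S) (sJS _ sQS) (subxx S)).
  exact: fusion_comp (sJS _ sP1S) (sJS _ sRS) (sJS _ sQS) Fk1 Fm.
move=> x Px; have P1x : x \in P1 by rewrite (subsetP (joing_subl _ _)).
have Qgx : g x \in Q by apply: fusion_mem FgQ P1x.
rewrite !ffunE k1k // -gf // -[in k x](hK x P1x).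
have -> : k (h (g x)) = l1 (g x) by rewrite l1l // ffunE.
by rewrite l1K // (subsetP (joing_subl _ _)).
Qed.

(** * Subgroups containing a maximal normal elementary abelian V *)

Section MaxNormalAbelem.
Variable V : {group gT}.
Hypotheses (p_odd : odd p) (maxV : [max V | V <| S & p.-abelem V]).
Hypothesis pV : p.-nat #|F V V|.

Let nsVS : V <| S. Proof. by case/maxgroupP: maxV => /andP[]. Qed.
Let abelV : p.-abelem V. Proof. by case/maxgroupP: maxV => /andP[]. Qed.
Let sVS : V \subset S. Proof. exact: normal_sub. Qed.
Let wcV : weakly_closed S F V. Proof. exact: wcF. Qed.

(** By weak closure an element [b] of prime order q different from p restricts to some [c] in
    Aut_F(V), a p-group. As [c ^+ q = 1], [c] is trivial, so [b] lies in the p-group of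
    automorphisms trivial on [V]. *)
Lemma AutF_pgroup P (sPS : P \subset S) : V \subset P ->
  p.-group (Group (AutF_group_set sPS)).
Proof.
move=> sVP; apply/pgroupP=> q pr_q /Cauchy[] // b /= Ab ob.
have [->|neq_qp] := eqVneq q p; first by rewrite inE.
have /AutFP[//|Aut_b [f Ff bf]] := Ab.
have FfS := fusion_widen sPS sPS (subxx S) Ff.
have fVV : f @: V = V := weakly_closed_im nsVS wcV sPS sVP FfS.
have FfV : restr V f \in F V V.
  apply: (fusion_onto sVS sPS (fusion_restr sVP sPS sPS Ff)).
  by rewrite -[RHS]fVV; apply/eq_in_imset/restrE.
have [c Ac cf] := AutF_of sVS FfV.
have cb : {in V, c =1 b}.
  by move=> x Vx; rewrite cf // restrE // bf // (subsetP sVP).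
have cX n : {in V, c ^+ n =1 b ^+ n}.
  elim: n => [|n IHn] x Vx; first by rewrite !expg0.
  rewrite !expgS !permM -cb // IHn //.
  exact: (AutF_weakly_closed nsVS wcV sVS (subxx V) Ac).
have c1 : c = 1.
  have cq : c ^+ q = 1.
    apply: (eq_Aut (A := V)); rewrite ?group1 //.
      by rewrite groupX //; case/setIdP: Ac.
    by move=> x Vx; rewrite cX // -ob expg_order.
  have p_c : p.-elt c.
    apply: (mem_p_elt (G := Group (AutF_group_set sVS))) => //.
    by rewrite pgroupE /= card_AutF.
  apply/eqP; rewrite -order_eq1 -dvdn1 -(eqP (_ : coprime #[c] q)).
    by rewrite dvdn_gcd dvdnn order_dvdn cq /=.
  by apply: pnat_coprime p_c _; rewrite p'natE // dvdn_prime2 // eq_sym.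
(* For odd p, maximality of [V] makes it equal to the subgroup generated by the elements of order p
   in ['C_S(V)]. *)
have max_V : {in 'C_P(V), forall x, x ^+ p = 1 -> x \in V}.
  move=> x /setIP[Px cVx] xp.
  rewrite -(Ohm1_cent_max_normal_abelem p_odd pS maxV).
  have pC : p.-group 'C_S(V) by apply: pgroupS (subsetIl _ _) pS.
  by rewrite (OhmE 1 pC) mem_gen // !inE (subsetP sPS) // cVx expn1 xp /=.
have nVP : P \subset 'N(V) := subset_trans sPS (normal_norm nsVS).
have pC := odd_stab_Aut_pgroup pr_p p_odd (pgroupS sPS pS) sVP nVP max_V.
suff cVb : b \in 'C(V | [Aut P]).
  by have := mem_p_elt pC cVb; rewrite /p_elt ob pnatE.
rewrite /= astab_ract inE Aut_b; apply/astabP=> x Vx /=.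
by rewrite -[RHS]perm1 -c1 cb.
Qed.

Lemma fusion_conjg P f : V \subset P -> P \subset S -> f \in F P S ->
  exists2 y, y \in S & {in P, forall x, f x = x ^ y}.
Proof.
have [n] := ubnP (#|S| - #|P|); elim: n P f => // n IHn P f ltPn sVP sPS Ff.
(* Stated for any [Q] of the order of [P], to serve both for [P] and for its image under [f]. *)
have to_fn (R Q : {group gT}) h : R \subset S -> fully_normalized S F R ->
    V \subset Q -> Q \subset S -> #|Q| = #|P| -> h \in F Q R -> h @: Q = R ->
    exists2 y, y \in S & {in Q, forall x, h x = x ^ y}.
  move=> sRS fnR sVQ sQS oQ Fh hQR.
  have FhS := fusion_widen sQS sRS (subxx S) Fh.
  have sVR : V \subset R.
    by rewrite -(weakly_closed_im nsVS wcV sQS sVQ FhS) -hQR imsetS.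
  (* A Sylow p-subgroup of a p-group is the whole group; hence [h] extends to all of ['N_S(Q)]. *)
  have defA : AutS R = AutF R.
    exact: pHall_id (AutS_Sylow sRS fnR) (AutF_pgroup sRS sVR).
  have [g Fg gh] : exists2 g, g \in F (Q <*> 'N_S(Q)) S & {in Q, g =1 h}.
    apply: (fully_normalized_extend sQS sRS fnR Fh hQR (subxx _)).
    by move=> v b _ Ab _; rewrite defA.
  have sQN : Q \subset 'N_S(Q) by rewrite subsetI sQS normG.
  (* For [Q = S] there is nothing to extend to, but then [R = Q] and [h] itself lies in Aut_S(Q).
     Otherwise ['N_S(Q)] is larger than [Q] and induction applies to [g]. *)
  have [eqQS | neqQS] := eqVneq (Q :> {set gT}) S.
    have defR : R = Q.
      have oR : #|R| = #|Q| by rewrite -hQR (card_in_imset (fusion_inj sQS sRS Fh)).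
      by apply/val_inj/eqP; rewrite /= eqEcard oR leqnn eqQS sRS.
    rewrite defR in Fh defA.
    have [b] := AutF_of sQS Fh; rewrite -defA => /AutSP[_ [y /setIP[Sy _] by_]] bh.
    by exists y => // x Qx; rewrite -bh // by_.
  have prQN : Q \proper 'N_S(Q).
    by apply: nilpotent_proper_norm (pgroup_nil pS) _; rewrite properEneq neqQS.
  rewrite (joing_idPr sQN) in Fg.
  have [|||y Sy gy] := IHn ('N_S(Q))%G g _ _ _ Fg.
  - rewrite -ltnS; apply: leq_trans ltPn; rewrite ltnS ltn_sub2l //= -oQ.
      by apply: leq_trans (proper_card prQN) (subset_leq_card (subsetIl _ _)).
    exact: proper_card prQN.
  - exact: subset_trans sVQ sQN.
  - exact: subsetIl.
  by exists y => // x Qx; rewrite -gh // gy // (subsetP sQN).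
have [Q [fPQ sQS oQ]] := fusion_img sPS (subxx S) Ff.
have FfQ := fusion_onto sPS (subxx S) Ff fPQ.
have [h [Fh hQP hK fK]] := fusion_inv sPS sQS FfQ fPQ.
have sVQ : V \subset Q.
  by rewrite -(weakly_closed_im nsVS wcV sPS sVP Ff) -fPQ imsetS.
have [R [sRS fnR [k Fk kPR]]] := fully_normalized_conj sPS.
have Fkh := fusion_comp sQS sPS sRS Fh Fk.
have khQR : fcomp k h @: Q = R.
  by rewrite -kPR -hQP -imset_comp; apply: eq_imset => x; rewrite ffunE.
have [y Sy ky] := to_fn R P k sRS fnR sVP sPS erefl Fk kPR.
have [z Sz khz] := to_fn R Q _ sRS fnR sVQ sQS oQ Fkh khQR.
(* [f] is [k] followed by the inverse of [fcomp k h]. *)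
exists (y * z^-1) => [|x Px]; first by rewrite groupM ?groupV.
have Qfx : f x \in Q by apply: fusion_mem FfQ Px.
by rewrite conjgM -ky // -{2}(hK x Px) -[k _](ffunE (fun x => k (h x))) khz // conjgK.
Qed.

End MaxNormalAbelem.
End FusionSystem.

(** * The nilpotency criterion, in both directions *)

Theorem theorem5p4 (gT : finGroupType) (p : nat) (S : {group gT})
  (F : {set gT} -> {set gT} -> {set {ffun gT -> gT}})
  (L : linking_system S F) :
  prime p -> odd p -> p.-group S -> saturated p S F ->
  (nilpotent_fs S F <->
   forall V : {group gT}, V <| S -> p.-abelem V ->
     weakly_closed S F V /\ p.-nat #|F V V|).
Proof.
move=> pr_p p_odd pS satF; have [fusF _ _] := satF; split=> [nilF V nsVS _|hV].
  (* Conjugation by S preserves the normal subgroup V, and Aut_S(V) is an image of the p-group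
     ['N_S(V)]. *)
  have sVS := normal_sub nsVS; split.
    move=> V' sV'S [f]; rewrite nilF // => /imsetP[x].
    rewrite inE => /andP[Sx _] -> <-.
    have -> : restr V (cmap x) @: V = V :^ x^-1 by apply/eq_in_imset/restrE.
    by apply: normP; rewrite groupV (subsetP (normal_norm nsVS)).
  rewrite nilF // -card_AutS //; apply: morphim_pgroup.
  exact: pgroupS (subsetIl _ _) pS.
move=> P Q sPS sQS; apply/eqP; rewrite eqEsubset.
have [-> _ _ _] := fusF P Q Q sPS sQS sQS; rewrite andbT.
have [V maxV _] : {V : {group gT} | [max V | V <| S & p.-abelem V] & 1%G \subset V}.
  by apply: maxgroup_exists; rewrite normal1 abelem1.
have /andP[nsVS abelV] := maxgroupp maxV.
have wcF (W : {group gT}) : W <| S -> p.-abelem W -> weakly_closed S F W.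
  by move=> nsWS abelW; have [] := hV W nsWS abelW.
have [_ pV] := hV V nsVS abelV.
apply/subsetP=> f Ff; have FfS := fusion_widen fusF sPS sQS (subxx S) Ff.
have [g Fg gf] := fusion_extend_abelem fusF pr_p pS satF wcF nsVS abelV sPS FfS.
have sPVS : P <*> V \subset S by rewrite join_subG sPS normal_sub.
have [y Sy gy] :=
  fusion_conjg fusF pr_p pS satF wcF p_odd maxV pV (joing_subr P V) sPVS Fg.
have fy : {in P, forall x, f x = x ^ y}.
  by move=> x Px; rewrite -gf // gy // (subsetP (joing_subl P V)).
(* [cmap y^-1] is [x |-> x ^ y]. *)
apply/imsetP; exists y^-1.
  rewrite inE groupV Sy invgK; apply/subsetP=> _ /imsetP[x Px ->].
  by rewrite -fy // (fusion_mem fusF sPS sQS Ff).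
apply/ffunP=> x; rewrite ffunE /cmap invgK; case: ifPn => [/fy // | nPx].
by rewrite (fusion_out fusF sPS sQS Ff).
Qed.
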